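(* There are structures $\mathcal{A}$ and $\mathcal{B}$ such that $\mathcal{A}$ is positive enumerably bi-transformable with $\mathcal{B}$ but $\mathcal{A}$ is not computably bi-transformable with $\mathcal{B}$.
   Context: Structures: all structures are countable with universe $\omega$, in a relational language $(R_i)_{i\in\omega}$ where $R_i$ has arity $a_i$ and $i\mapsto a_i$ is computable. The languages of $\mathcal{A}$ and $\mathcal{B}$ may differ. A class of structures (in a fixed language) is viewed as a category whose morphisms are the isomorphisms between its members; $Hom(\mathcal{A},\mathcal{B})$ is the set of isomorphisms from $\mathcal{A}$ to $\mathcal{B}$. $Iso(\mathcal{A})=\{\mathcal{C}:\mathcal{C}\cong\mathcal{A}\}$ (structures with universe $\omega$); a functor $F:\mathcal{A}\to\mathcal{B}$ means a functor $F:Iso(\mathcal{A})\to Iso(\mathcal{B})$. A functor maps structures to structures and isomorphisms $f:\mathcal{C}\to\mathcal{D}$ to isomorphisms $F(f):F(\mathcal{C})\to F(\mathcal{D})$, preserving composition and identities. Coding: tuples of natural numbers are coded by numbers via a fixed computable coding $\langle\cdot\rangle$, and $\oplus$ and $\bigoplus_{i\in\omega}$ denote the usual effective joins of sets. $Graph(f)=\{\langle x,y\rangle: f(x)=y\}$. The atomic diagram of $\mathcal{A}$ is $D(\mathcal{A})=\bigoplus_{i\in\omega}R_i^{\mathcal{A}}\oplus\bigoplus_{i\in\omega}\neg R_i^{\mathcal{A}}$. The positive diagram of $\mathcal{A}$ is $P(\mathcal{A})={=}\oplus{\neq}\oplus\bigoplus_{i\in\omega}R_i^{\mathcal{A}}$,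 where $=$ and $\neq$ are equality and inequality on $\omega$. An enumeration operator $\Psi$ is a c.e. set of pairs $(E,x)$ with $E$ (a code of) a finite set, and $\Psi^X=\{x:\exists E\subseteq X\ (E,x)\in\Psi\}$. For a Turing operator $\Phi$ and a set $Y$, $\Phi^X=Y$ means that $\Phi$ computes the characteristic function of $Y$ from the oracle $X$; for a function $g$, $\Phi^X=g$ means $\Phi$ computes $g$ from $X$. Computable notions: a functor $F:\mathfrak{C}\to\mathfrak{D}$ is computable if there are Turing operators $\Phi,\Phi_*$ such that for all $\mathcal{C}_1,\mathcal{C}_2\in\mathfrak{C}$: (1) $\Phi^{D(\mathcal{C}_1)}=D(F(\mathcal{C}_1))$; (2) for all $f\in Hom(\mathcal{C}_1,\mathcal{C}_2)$, $\Phi_*^{D(\mathcal{C}_1)\oplus Graph(f)\oplus D(\mathcal{C}_2)}=F(f)$. A functor $F:\mathfrak{C}\to\mathfrak{D}$ is effectively isomorphic to $G:\mathfrak{C}\to\mathfrak{D}$ via a Turing functional $\Lambda$ if for every $\mathcal{C}\in\mathfrak{C}$, $\Lambda^{\mathcal{C}}$ (computed with oracle $D(\mathcal{C})$) is an isomorphism $F(\mathcal{C})\to G(\mathcal{C})$, and for every $h\in Hom(\mathcal{C}_1,\mathcal{C}_2)$ in $\mathfrak{C}$, $\Lambda^{\mathcal{C}_2}\circ F(h)=G(h)\circ\Lambda^{\mathcal{C}_1}$. Functors $F:\mathfrak{C}\to\mathfrak{D}$, $G:\mathfrak{D}\to\mathfrak{C}$ are pseudo inverses if there are Turing functionals $\Lambda_{\mathfrak{C}},\Lambda_{\mathfrak{D}}$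 such that $Id_{\mathfrak{C}}$ is effectively isomorphic to $G\circ F$ via $\Lambda_{\mathfrak{C}}$, $Id_{\mathfrak{D}}$ is effectively isomorphic to $F\circ G$ via $\Lambda_{\mathfrak{D}}$, and for all $\mathcal{C}\in\mathfrak{C}$, $\mathcal{E}\in\mathfrak{D}$: $\Lambda_{\mathfrak{D}}^{F(\mathcal{C})}=F(\Lambda_{\mathfrak{C}}^{\mathcal{C}}):F(\mathcal{C})\to F(G(F(\mathcal{C})))$ and $\Lambda_{\mathfrak{C}}^{G(\mathcal{E})}=G(\Lambda_{\mathfrak{D}}^{\mathcal{E}}):G(\mathcal{E})\to G(F(G(\mathcal{E})))$. Structures $\mathcal{A},\mathcal{B}$ are computably bi-transformable if there are computable pseudo-inverse functors $F:\mathcal{A}\to\mathcal{B}$ and $G:\mathcal{B}\to\mathcal{A}$. Positive enumerable notions: a functor $F:\mathfrak{C}\to\mathfrak{D}$ is positive enumerable if there are enumeration operators $\Psi,\Psi_*$ such that for all $\mathcal{C}_1,\mathcal{C}_2\in\mathfrak{C}$: (1) $\Psi^{P(\mathcal{C}_1)}=P(F(\mathcal{C}_1))$; (2) for all $f\in Hom(\mathcal{C}_1,\mathcal{C}_2)$, $\Psi_*^{P(\mathcal{C}_1)\oplus Graph(f)\oplus P(\mathcal{C}_2)}=Graph(F(f))$. Enumeration isomorphic functors and enumeration pseudo inverses are defined exactly as effectively isomorphic functors and pseudo inverses, except that the Turing functionals $\Lambda$ with oracle $D(\cdot)$ are replaced by enumeration operators $\Lambda$ with input $P(\cdot)$, enumerating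 the graph of the isomorphism. Structures $\mathcal{A},\mathcal{B}$ are positive enumerably bi-transformable if there are positive enumerable functors $F:\mathcal{A}\to\mathcal{B}$ and $G:\mathcal{B}\to\mathcal{A}$ that are enumeration pseudo inverses. *)

(* Defs.v *)
From Stdlib Require Import Arith Cantor Vector FinFun.
From Stdlib Require Import Program.Basics.

Set Implicit Arguments.
Unset Strict Implicit.
Open Scope nat_scope.

Notation "⟨ x , y ⟩" := (Cantor.to_nat (x, y)) (at level 0, x at level 99, y at level 99).

(* Partial recursive functions relative to an oracle, presented as unary
   functions on [nat] with Cantor pairing among the initial functions. *)
Inductive code : Type :=
| Zero | Succ | Left | Right
| Oracle                      (* characteristic function of the oracle *)
| Pair (c d : code)           (* x |-> ⟨c x, d x⟩ *)
| Comp (c d : code)           (* x |-> c (d x) *)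
| Prec (c d : code)           (* ⟨a, 0⟩ |-> c a,  ⟨a, m+1⟩ |-> d ⟨a, ⟨m, value at ⟨a, m⟩⟩⟩ *)
| Mu (c : code).              (* x |-> least y with c ⟨x, y⟩ = 0 *)

Definition char_fun (X : nat -> Prop) (n b : nat) : Prop :=
  (X n /\ b = 1) \/ (~ X n /\ b = 0).

(* Graph of the partial function defined by recursion from the partial value
   [base] and the partial step [step m previous]. *)
Fixpoint prec_graph (base : nat -> Prop) (step : nat -> nat -> nat -> Prop)
    (n y : nat) : Prop :=
  match n with
  | 0 => base y
  | S m => exists r, prec_graph base step m r /\ step m r y
  end.

(* [eval X c x y]: program [c] with oracle [X] halts on input [x] with output [y]. *)
Fixpoint eval (X : nat -> Prop) (c : code) (x y : nat) : Prop :=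
  match c with
  | Zero => y = 0
  | Succ => y = S x
  | Left => y = fst (Cantor.of_nat x)
  | Right => y = snd (Cantor.of_nat x)
  | Oracle => char_fun X x y
  | Pair c d => exists u v, eval X c x u /\ eval X d x v /\ y = ⟨u, v⟩
  | Comp c d => exists u, eval X d x u /\ eval X c u y
  | Prec c d =>
      let (a, n) := Cantor.of_nat x in
      prec_graph (eval X c a) (fun m r z => eval X d ⟨a, ⟨m, r⟩⟩ z) n y
  | Mu c =>
      eval X c ⟨x, y⟩ 0 /\ forall z, z < y -> exists k, eval X c ⟨x, z⟩ (S k)
  end.

(* Φ^X = g for a function g, and Φ^X = Y for a set Y. *)
Definition turing_fun (c : code) (X : nat -> Prop) (g : nat -> nat) : Prop :=
  forall n, eval X c n (g n).

Definition turing_set (c : code) (X Y : nat -> Prop) : Prop :=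
  forall n b, char_fun Y n b -> eval X c n b.

Definition empty_set (_ : nat) : Prop := False.

Definition computable_fun (g : nat -> nat) : Prop :=
  exists c, turing_fun c empty_set g.

Definition ce (W : nat -> Prop) : Prop :=
  exists c, forall x, W x <-> exists y, eval empty_set c x y.

(* The finite set with canonical index [u]. *)
Definition fin_set (u k : nat) : Prop := Nat.testbit u k = true.

Record enum_operator : Type := EnumOperator {
  enum_pairs :> nat -> Prop;
  enum_pairs_ce : ce enum_pairs }.

Definition enum_apply (Psi : enum_operator) (X : nat -> Prop) (x : nat) : Prop :=
  exists u, (forall k, fin_set u k -> X k) /\ Psi ⟨u, x⟩.

Definition enumerates (Psi : enum_operator) (X Y : nat -> Prop) : Prop :=
  forall x, enum_apply Psi X x <-> Y x.

(* ⟨x⟩ = x and ⟨x_1, ..., x_n⟩ = ⟨x_1, ⟨x_2, ..., x_n⟩⟩. *)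
Fixpoint tuple_code (n : nat) (v : Vector.t nat n) : nat :=
  match v with
  | Vector.nil _ => 0
  | Vector.cons _ x m w =>
      match m with
      | 0 => x
      | S _ => ⟨x, tuple_code w⟩
      end
  end.

Definition join (X Y : nat -> Prop) (n : nat) : Prop :=
  (exists m, n = 2 * m /\ X m) \/ (exists m, n = 2 * m + 1 /\ Y m).

Definition infinite_join (X : nat -> nat -> Prop) (n : nat) : Prop :=
  exists i x, n = ⟨i, x⟩ /\ X i x.

Definition Graph (f : nat -> nat) (n : nat) : Prop :=
  exists x, n = ⟨x, f x⟩.

Definition eq_set (n : nat) : Prop := exists x y, n = ⟨x, y⟩ /\ x = y.
Definition neq_set (n : nat) : Prop := exists x y, n = ⟨x, y⟩ /\ x <> y.

Record language : Type := Language {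
  arity : nat -> nat;
  arity_pos : forall i, 0 < arity i;
  arity_computable : computable_fun arity }.

Record structure (L : language) : Type := Structure {
  rel : forall i, Vector.t nat (arity L i) -> Prop }.

Definition is_iso (L : language) (C D : structure L) (f : nat -> nat) : Prop :=
  Bijective f /\
  forall i (v : Vector.t nat (arity L i)), rel C v <-> rel D (Vector.map f v).

Definition rel_codes (L : language) (C : structure L) (i n : nat) : Prop :=
  exists v : Vector.t nat (arity L i), n = tuple_code v /\ rel C v.

Definition neg_rel_codes (L : language) (C : structure L) (i n : nat) : Prop :=
  exists v : Vector.t nat (arity L i), n = tuple_code v /\ ~ rel C v.

Definition atomic_diagram (L : language) (C : structure L) : nat -> Prop :=
  join (infinite_join (rel_codes C)) (infinite_join (neg_rel_codes C)).

Definition positive_diagram (L : language) (C : structure L) : nat -> Prop :=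
  join eq_set (join neq_set (infinite_join (rel_codes C))).

Definition class (L : language) : Type := structure L -> Prop.

Definition Iso (L : language) (A : structure L) : class L :=
  fun C => exists f, is_iso C A f.

(* [mor C1 C2 f] is the image of the morphism f : C1 -> C2.  The maps [obj] and
   [mor] are total; only their values on members of [CC] and on isomorphisms
   between them carry meaning, and only these are constrained or used. *)
Record functor (L L' : language) (CC : class L) (DD : class L') : Type := Functor {
  obj :> structure L -> structure L';
  mor : structure L -> structure L -> (nat -> nat) -> (nat -> nat);
  obj_in : forall C, CC C -> DD (obj C);
  mor_iso : forall C1 C2 f, CC C1 -> CC C2 ->
    is_iso C1 C2 f -> is_iso (obj C1) (obj C2) (mor C1 C2 f);
  mor_id : forall C, CC C -> mor C C id = id;
  mor_comp : forall C1 C2 C3 f g, CC C1 -> CC C2 -> CC C3 ->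
    is_iso C1 C2 f -> is_iso C2 C3 g ->
    mor C1 C3 (compose g f) = compose (mor C2 C3 g) (mor C1 C2 f) }.

Definition id_functor (L : language) (CC : class L) : functor CC CC.
Proof.
refine (@Functor L L CC CC (fun C => C) (fun _ _ f => f) _ _ _ _); auto.
Defined.

Definition comp_functor (L1 L2 L3 : language)
    (CC : class L1) (DD : class L2) (EE : class L3)
    (G : functor DD EE) (F : functor CC DD) : functor CC EE.
Proof.
refine (@Functor L1 L3 CC EE (fun C => G (F C))
  (fun C1 C2 f => mor G (F C1) (F C2) (mor F C1 C2 f)) _ _ _ _).
- intros C HC; apply (obj_in G), (obj_in F), HC.
- intros C1 C2 f H1 H2 Hf.
  apply (mor_iso G); [apply (obj_in F), H1 | apply (obj_in F), H2 |].
  exact (mor_iso F H1 H2 Hf).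
- intros C HC; rewrite (mor_id F HC); apply (mor_id G), (obj_in F), HC.
- intros C1 C2 C3 f g H1 H2 H3 Hf Hg.
  rewrite (mor_comp F H1 H2 H3 Hf Hg).
  apply (mor_comp G); try (apply (obj_in F); assumption).
  + exact (mor_iso F H1 H2 Hf).
  + exact (mor_iso F H2 H3 Hg).
Defined.

(* The computable and the enumeration versions differ only in how an operator
   Λ yields a function Λ^C from a structure C.  A [realization] is the
   relation "Λ^C = g" for a given operator Λ. *)
Definition realization (L : language) : Type := structure L -> (nat -> nat) -> Prop.

Definition turing_real (L : language) (c : code) : realization L :=
  fun C g => turing_fun c (atomic_diagram C) g.

Definition enum_real (L : language) (Psi : enum_operator) : realization L :=
  fun C g => enumerates Psi (positive_diagram C) (Graph g).

(* The realizations used below determine g from C, so quantifying over all g with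
   Λ^C = g, once such a g is known to exist, is the same as speaking of Λ^C. *)
Definition isomorphic_via (L L' : language) (CC : class L) (DD : class L')
    (F G : functor CC DD) (Lam : realization L) : Prop :=
  (forall C, CC C -> exists g, Lam C g /\ is_iso (F C) (G C) g) /\
  (forall C1 C2 h g1 g2, CC C1 -> CC C2 -> is_iso C1 C2 h ->
     Lam C1 g1 -> Lam C2 g2 ->
     compose g2 (mor F C1 C2 h) = compose (mor G C1 C2 h) g1).

Definition pseudo_inverse_via (L L' : language) (CC : class L) (DD : class L')
    (F : functor CC DD) (G : functor DD CC)
    (LamC : realization L) (LamD : realization L') : Prop :=
  isomorphic_via (id_functor CC) (comp_functor G F) LamC /\
  isomorphic_via (id_functor DD) (comp_functor F G) LamD /\
  (forall C g, CC C -> LamC C g -> LamD (F C) (mor F C (G (F C)) g)) /\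
  (forall E g, DD E -> LamD E g -> LamC (G E) (mor G E (F (G E)) g)).

Definition computable_pseudo_inverses (L L' : language) (CC : class L) (DD : class L')
    (F : functor CC DD) (G : functor DD CC) : Prop :=
  exists cC cD : code,
    pseudo_inverse_via F G (turing_real cC) (turing_real cD).

Definition enum_pseudo_inverses (L L' : language) (CC : class L) (DD : class L')
    (F : functor CC DD) (G : functor DD CC) : Prop :=
  exists PsiC PsiD : enum_operator,
    pseudo_inverse_via F G (enum_real PsiC) (enum_real PsiD).

Definition computable_functor (L L' : language) (CC : class L) (DD : class L')
    (F : functor CC DD) : Prop :=
  exists c cs : code,
    (forall C, CC C -> turing_set c (atomic_diagram C) (atomic_diagram (F C))) /\
    (forall C1 C2 f, CC C1 -> CC C2 -> is_iso C1 C2 f ->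
       turing_fun cs
         (join (atomic_diagram C1) (join (Graph f) (atomic_diagram C2)))
         (mor F C1 C2 f)).

Definition positive_enumerable_functor (L L' : language) (CC : class L) (DD : class L')
    (F : functor CC DD) : Prop :=
  exists Psi Psis : enum_operator,
    (forall C, CC C ->
       enumerates Psi (positive_diagram C) (positive_diagram (F C))) /\
    (forall C1 C2 f, CC C1 -> CC C2 -> is_iso C1 C2 f ->
       enumerates Psis
         (join (positive_diagram C1) (join (Graph f) (positive_diagram C2)))
         (Graph (mor F C1 C2 f))).

Definition computably_bitransformable (L L' : language)
    (A : structure L) (B : structure L') : Prop :=
  exists (F : functor (Iso A) (Iso B)) (G : functor (Iso B) (Iso A)),
    computable_functor F /\ computable_functor G /\
    computable_pseudo_inverses F G.

Definition positive_enumerably_bitransformable (L L' : language)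
    (A : structure L) (B : structure L') : Prop :=
  exists (F : functor (Iso A) (Iso B)) (G : functor (Iso B) (Iso A)),
    positive_enumerable_functor F /\ positive_enumerable_functor G /\
    enum_pseudo_inverses F G.

(* Main.v *)
Require Import Defs.
From Stdlib Require Import Arith Cantor Vector FinFun Lia Setoid.
From Stdlib Require Import Classical FunctionalExtensionality.

(** The structures that separate the two notions carry no information apart from a set [X] of natural
    numbers: in [flag_structure X] the unary relation [R_i] holds of every element if [i] is in [X],
    and of no element otherwise.  Every permutation of the universe is then an automorphism and every
    copy has the same diagrams, so the functor that is constant on objects and the identity on
    morphisms relates any two such structures.  Whether it is positive enumerable depends only on the
    two sets: the positive diagram is enumeration equivalent to [X], the atomic diagram is Turing
    equivalent to [X].  It remains to find [U] and [V] that enumerate each other such that [V] is not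
    computable from [U].

    [V] consists of a copy of [U] and of its projection [{e | exists s, U ⟨e, s⟩}]; each of [U] and [V]
    is the set of all [g n] such that [f n] lies in the other, with computable [f] and [g]
    ([positive_diagram_reduction]).  [U] is chosen so that its projection is a halting problem relative
    to [U] itself: [⟨e, s⟩] is put into [U] when the program with index [e] returns 0 at a fixed input
    depending on [e], and its computation asks only about numbers less than [s].  This is a legitimate
    recursion because it consults [U] only below [s <= ⟨e, s⟩] ([causal_fixpoint]), and by the finiteness
    of computations ([eval_use]) the projection of [U] is then exactly the set of indices of programs
    that return 0 there ([diagonal_oracle]).  A program that computes the projection from the atomic
    diagram would have to return 0 at its own index if and only if it returns 1.  Relativizing in this
    way makes a universal program unnecessary. *)

(** * Properties of oracle computations *)

Lemma eval_deterministic (X : nat -> Prop) (c : code) :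
  forall x y z, eval X c x y -> eval X c x z -> y = z.
Proof.
induction c as [| | | | |c IHc d IHd|c IHc d IHd|c IHc d IHd|c IHc];
  simpl; intros x y z Hy Hz; try congruence.
- destruct Hy as [[? ?]|[? ?]], Hz as [[? ?]|[? ?]]; congruence || contradiction.
- destruct Hy as (u & v & Hu & Hv & ->), Hz as (u' & v' & Hu' & Hv' & ->).
  now rewrite (IHc _ _ _ Hu Hu'), (IHd _ _ _ Hv Hv').
- destruct Hy as (u & Hu & Hy), Hz as (u' & Hu' & Hz).
  rewrite (IHd _ _ _ Hu Hu') in Hy; eauto.
- destruct (Cantor.of_nat x) as [a n].
  revert y z Hy Hz; induction n as [|n IHn]; simpl; intros y z Hy Hz; [eauto|].
  destruct Hy as (r & Hr & Hy), Hz as (r' & Hr' & Hz).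
  rewrite (IHn _ _ Hr Hr') in Hy; eauto.
- destruct Hy as [Hy My], Hz as [Hz Mz].
  destruct (Nat.lt_trichotomy y z) as [H|[H|H]]; auto.
  + destruct (Mz _ H) as [k Hk]; discriminate (IHc _ _ _ Hy Hk).
  + destruct (My _ H) as [k Hk]; discriminate (IHc _ _ _ Hz Hk).
Qed.

Definition agree_below (s : nat) (X Y : nat -> Prop) : Prop :=
  forall k, k < s -> (X k <-> Y k).

Lemma agree_below_le (s t : nat) (X Y : nat -> Prop) :
  s <= t -> agree_below t X Y -> agree_below s X Y.
Proof. intros Hst H k Hk; apply H; lia. Qed.

Definition finite_use (X : nat -> Prop) (P : (nat -> Prop) -> Prop) : Prop :=
  exists s, forall Y, agree_below s X Y -> P Y.

Lemma finite_use_and (X : nat -> Prop) (P Q : (nat -> Prop) -> Prop) :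
  finite_use X P -> finite_use X Q -> finite_use X (fun Y => P Y /\ Q Y).
Proof.
intros [s Hs] [t Ht]; exists (s + t); intros Y HY.
split; [apply Hs | apply Ht]; apply (agree_below_le _ (s + t)); auto; lia.
Qed.

Lemma finite_use_impl (X : nat -> Prop) (P Q : (nat -> Prop) -> Prop) :
  (forall Y, P Y -> Q Y) -> finite_use X P -> finite_use X Q.
Proof. intros HPQ [s Hs]; exists s; auto. Qed.

Lemma finite_use_forall_lt (X : nat -> Prop) (P : nat -> (nat -> Prop) -> Prop) (n : nat) :
  (forall z, z < n -> finite_use X (P z)) ->
  finite_use X (fun Y => forall z, z < n -> P z Y).
Proof.
induction n as [|n IHn]; intros H.
- exists 0; intros; lia.
- assert (Hn : finite_use X (fun Y => forall z, z < n -> P z Y)) by (apply IHn; intros; apply H; lia).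
  refine (finite_use_impl _ _ _ _ (finite_use_and _ _ _ Hn (H n (Nat.lt_succ_diag_r n)))).
  intros Y [H1 H2] z Hz; destruct (Nat.eq_dec z n) as [->|]; [assumption | apply H1; lia].
Qed.

(** A halting computation consults the oracle finitely often; the unbounded search is harmless because
    it stops at some [y], so that only the finitely many searches below [y] count. *)
Lemma eval_use (X : nat -> Prop) (c : code) :
  forall x y, eval X c x y -> finite_use X (fun Y => eval Y c x y).
Proof.
induction c as [| | | | |c IHc d IHd|c IHc d IHd|c IHc d IHd|c IHc]; simpl; intros x y H;
  try (exists 0; intros; exact H).
- exists (S x); intros Y HY; specialize (HY x (Nat.lt_succ_diag_r x)).
  unfold char_fun in *; tauto.
- destruct H as (u & v & Hu & Hv & E).
  refine (finite_use_impl _ _ _ _ (finite_use_and _ _ _ (IHc _ _ Hu) (IHd _ _ Hv))).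
  intros Y [? ?]; eauto.
- destruct H as (u & Hu & Hy).
  refine (finite_use_impl _ _ _ _ (finite_use_and _ _ _ (IHd _ _ Hu) (IHc _ _ Hy))).
  intros Y [? ?]; eauto.
- destruct (Cantor.of_nat x) as [a n].
  revert y H; induction n as [|n IHn]; simpl; intros y H; [auto|].
  destruct H as (r & Hr & Hy).
  refine (finite_use_impl _ _ _ _ (finite_use_and _ _ _ (IHn _ Hr) (IHd _ _ Hy))).
  intros Y [? ?]; eauto.
- destruct H as [H0 HS].
  apply finite_use_and; [auto|].
  apply finite_use_forall_lt; intros z Hz; destruct (HS z Hz) as [k Hk].
  refine (finite_use_impl _ _ _ _ (IHc _ _ Hk)); eauto.
Qed.

Lemma pair_inj (a b c d : nat) : ⟨a, b⟩ = ⟨c, d⟩ -> a = c /\ b = d.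
Proof. intros H; apply Cantor.to_nat_inj in H; injection H; auto. Qed.

Lemma pair_bounds (a b : nat) : a <= ⟨a, b⟩ /\ b <= ⟨a, b⟩.
Proof. pose proof (Cantor.to_nat_non_decreasing a b); lia. Qed.

Fixpoint code_index (c : code) : nat :=
  match c with
  | Zero => ⟨0, 0⟩
  | Succ => ⟨1, 0⟩
  | Left => ⟨2, 0⟩
  | Right => ⟨3, 0⟩
  | Oracle => ⟨4, 0⟩
  | Pair c d => ⟨5, ⟨code_index c, code_index d⟩⟩
  | Comp c d => ⟨6, ⟨code_index c, code_index d⟩⟩
  | Prec c d => ⟨7, ⟨code_index c, code_index d⟩⟩
  | Mu c => ⟨8, code_index c⟩
  end.

Lemma code_index_inj (c d : code) : code_index c = code_index d -> c = d.
Proof.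
revert d; induction c; intros []; cbn [code_index]; intros H;
  apply pair_inj in H as [H1 H2]; try discriminate; auto;
  try (apply pair_inj in H2 as [H2 H3]); f_equal; auto.
Qed.

(** * Computable functions *)

Lemma computable_ext (f g : nat -> nat) :
  (forall n, f n = g n) -> computable_fun f -> computable_fun g.
Proof. intros E [c Hc]; exists c; intros n; rewrite <- E; apply Hc. Qed.

Lemma computable_comp (f g : nat -> nat) :
  computable_fun f -> computable_fun g -> computable_fun (fun n => f (g n)).
Proof. intros [c Hc] [d Hd]; exists (Comp c d); intros n; simpl; eauto. Qed.

Lemma computable_pair (f g : nat -> nat) :
  computable_fun f -> computable_fun g -> computable_fun (fun n => ⟨f n, g n⟩).
Proof.
intros [c Hc] [d Hd]; exists (Pair c d); intros n; exists (f n), (g n); auto.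
Qed.

Definition pfst (n : nat) : nat := fst (Cantor.of_nat n).
Definition psnd (n : nat) : nat := snd (Cantor.of_nat n).

#[local] Arguments Cantor.to_nat : simpl never.
#[local] Arguments pfst : simpl never.
#[local] Arguments psnd : simpl never.

Lemma pfst_pair (a b : nat) : pfst ⟨a, b⟩ = a.
Proof. unfold pfst; now rewrite Cantor.cancel_of_to. Qed.

Lemma psnd_pair (a b : nat) : psnd ⟨a, b⟩ = b.
Proof. unfold psnd; now rewrite Cantor.cancel_of_to. Qed.

Lemma pair_eta (n : nat) : ⟨pfst n, psnd n⟩ = n.
Proof. unfold pfst, psnd; rewrite <- surjective_pairing; apply Cantor.cancel_to_of. Qed.

Lemma computable_pfst (f : nat -> nat) :
  computable_fun f -> computable_fun (fun n => pfst (f n)).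
Proof. apply computable_comp; exists Left; intros n; reflexivity. Qed.

Lemma computable_psnd (f : nat -> nat) :
  computable_fun f -> computable_fun (fun n => psnd (f n)).
Proof. apply computable_comp; exists Right; intros n; reflexivity. Qed.

Lemma computable_id : computable_fun (fun n => n).
Proof.
apply (computable_ext (fun n => ⟨pfst n, psnd n⟩)); [exact pair_eta|].
apply computable_pair; [exists Left | exists Right]; intros n; reflexivity.
Qed.

Lemma computable_succ (f : nat -> nat) :
  computable_fun f -> computable_fun (fun n => S (f n)).
Proof. apply computable_comp; exists Succ; intros n; reflexivity. Qed.

Lemma computable_const (k : nat) : computable_fun (fun _ => k).
Proof.
induction k as [|k IHk]; [exists Zero; intros n; reflexivity | now apply computable_succ].
Qed.

Lemma computable_rec (a b k : nat -> nat) :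
  computable_fun a -> computable_fun b -> computable_fun k ->
  computable_fun (fun n => nat_rec (fun _ => nat) (a n) (fun m r => b ⟨n, ⟨m, r⟩⟩) (k n)).
Proof.
intros [c Hc] [d Hd] Hk.
destruct (computable_pair _ _ computable_id Hk) as [e He].
exists (Comp (Prec c d) e); intros n; exists ⟨n, k n⟩; split; [apply He|].
cbn [eval]; rewrite Cantor.cancel_of_to.
generalize (k n); clear -Hc Hd; intros m.
induction m as [|m IHm]; simpl; [apply Hc | eauto].
Qed.

Lemma computable_case (a b k : nat -> nat) :
  computable_fun a -> computable_fun b -> computable_fun k ->
  computable_fun (fun n => match k n with 0 => a n | S _ => b n end).
Proof.
intros Ha Hb Hk.
refine (computable_ext _ _ _
  (computable_rec a (fun p => b (pfst p)) k Ha (computable_comp _ _ Hb _) Hk)).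
- intros n; simpl; destruct (k n); simpl; [|rewrite pfst_pair]; reflexivity.
- apply computable_pfst, computable_id.
Qed.

Lemma computable_add (f g : nat -> nat) :
  computable_fun f -> computable_fun g -> computable_fun (fun n => f n + g n).
Proof.
intros Hf Hg.
refine (computable_ext _ _ _ (computable_rec f (fun p => S (psnd (psnd p))) g Hf _ Hg)).
- intros n; simpl; induction (g n) as [|m IHm]; simpl; [lia|].
  rewrite !psnd_pair, IHm; lia.
- apply computable_succ, computable_psnd, computable_psnd, computable_id.
Qed.

Lemma computable_pred (f : nat -> nat) :
  computable_fun f -> computable_fun (fun n => pred (f n)).
Proof.
intros Hf.
refine (computable_ext _ _ _
  (computable_rec (fun _ => 0) (fun p => pfst (psnd p)) f (computable_const 0) _ Hf)).
- intros n; simpl; destruct (f n); simpl; [|rewrite psnd_pair, pfst_pair]; reflexivity.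
- apply computable_pfst, computable_psnd, computable_id.
Qed.

Lemma computable_sub (f g : nat -> nat) :
  computable_fun f -> computable_fun g -> computable_fun (fun n => f n - g n).
Proof.
intros Hf Hg.
refine (computable_ext _ _ _ (computable_rec f (fun p => pred (psnd (psnd p))) g Hf _ Hg)).
- intros n; simpl; induction (g n) as [|m IHm]; simpl; [lia|].
  rewrite !psnd_pair, IHm; lia.
- apply computable_pred, computable_psnd, computable_psnd, computable_id.
Qed.

Lemma computable_double (f : nat -> nat) :
  computable_fun f -> computable_fun (fun n => 2 * f n).
Proof.
intros Hf; apply (computable_ext (fun n => f n + f n)); [intros; lia|].
now apply computable_add.
Qed.

Lemma computable_pow2 (f : nat -> nat) :
  computable_fun f -> computable_fun (fun n => 2 ^ f n).
Proof.
intros Hf.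
refine (computable_ext _ _ _
  (computable_rec (fun _ => 1) (fun p => 2 * psnd (psnd p)) f (computable_const 1) _ Hf)).
- intros n; cbv beta; induction (f n) as [|m IHm]; [reflexivity|].
  cbn [nat_rec nat_rect]; rewrite !psnd_pair.
  etransitivity; [exact (f_equal (Nat.mul 2) IHm) | reflexivity].
- apply computable_double, computable_psnd, computable_psnd, computable_id.
Qed.

Create HintDb computable.
#[local] Hint Resolve computable_pair computable_pfst computable_psnd computable_id
  computable_succ computable_const computable_case computable_add computable_sub
  computable_double computable_pow2 : computable.

(** * Enumeration operators with singleton premises *)

Lemma least_zero (f : nat -> nat) (n : nat) :
  f n = 0 -> exists m, f m = 0 /\ forall k, k < m -> f k <> 0.
Proof.
induction n as [n IHn] using lt_wf_ind; intros Hn.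
destruct (classic (exists k, k < n /\ f k = 0)) as [(k & Hk & E)|H]; [eauto|].
exists n; split; [assumption|]; intros k Hk E; eauto.
Qed.

(** To semidecide membership of [x], search for a zero of the distance between [x] and [h n]. *)
Lemma ce_range (h : nat -> nat) : computable_fun h -> ce (fun x => exists n, x = h n).
Proof.
intros Hh.
set (t := fun p => (pfst p - h (psnd p)) + (h (psnd p) - pfst p)).
assert (Ht : computable_fun t).
{ assert (computable_fun (fun p => h (psnd p)))
    by (apply computable_comp; auto with computable).
  unfold t; auto with computable. }
destruct Ht as [c Hc].
assert (Ec : forall x n, t ⟨x, n⟩ = 0 <-> x = h n).
{ intros x n; unfold t; rewrite pfst_pair, psnd_pair; lia. }
exists (Mu c); intros x; split.
- intros [n Hn]; destruct (least_zero (fun n => t ⟨x, n⟩) n) as (m & Hm & Hlt);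
    [now apply Ec|].
  exists m; split; [rewrite <- Hm; apply Hc|].
  intros z Hz; exists (pred (t ⟨x, z⟩)); specialize (Hlt z Hz); simpl in Hlt.
  replace (S (pred (t ⟨x, z⟩))) with (t ⟨x, z⟩) by lia; apply Hc.
- intros (n & Hn & _); exists n; apply Ec.
  exact (eval_deterministic _ _ _ _ _ (Hc _) Hn).
Qed.

(** The axioms of the operator are the pairs of the form [({f n}, g n)]; the set [{f n}] has canonical
    index [2 ^ f n].  All reductions below have this form. *)
Lemma singleton_operator (f g : nat -> nat) :
  computable_fun f -> computable_fun g ->
  exists Psi : enum_operator, forall X x, enum_apply Psi X x <-> exists n, X (f n) /\ x = g n.
Proof.
intros Hf Hg.
assert (H : computable_fun (fun n => ⟨2 ^ f n, g n⟩)) by auto with computable.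
exists (EnumOperator (ce_range _ H)); intros X x; unfold enum_apply; simpl; split.
- intros (u & Hu & n & E); apply pair_inj in E as [-> ->].
  exists n; split; [|reflexivity].
  apply Hu; unfold fin_set; apply Nat.pow2_bits_true.
- intros (n & Hn & ->); exists (2 ^ f n); split; [|eauto].
  intros k Hk; unfold fin_set in Hk; rewrite Nat.pow2_bits_eqb in Hk.
  apply Nat.eqb_eq in Hk as <-; assumption.
Qed.

(** * Structures that encode a set *)

Definition unary_language : language :=
  Language (arity := fun _ => 1) (fun _ => Nat.lt_0_1) (computable_const 1).

Definition flag_structure (X : nat -> Prop) : structure unary_language :=
  Structure (L := unary_language) (fun i _ => X i).

Lemma iso_flag_rel (X : nat -> Prop) (C : structure unary_language) :
  Iso (flag_structure X) C -> forall i v, rel C (i := i) v <-> X i.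
Proof. intros (f & _ & H) i v; exact (H i v). Qed.

Lemma iso_flag_refl (X : nat -> Prop) : Iso (flag_structure X) (flag_structure X).
Proof. exists id; split; [exists id; split; reflexivity | reflexivity]. Qed.

Lemma iso_flag_bijective (X : nat -> Prop) (C D : structure unary_language) (f : nat -> nat) :
  Iso (flag_structure X) C -> Iso (flag_structure X) D -> Bijective f -> is_iso C D f.
Proof.
intros HC HD Hf; split; [assumption|]; intros i v.
rewrite (iso_flag_rel _ _ HC), (iso_flag_rel _ _ HD); reflexivity.
Qed.

Lemma iso_flag_positive_diagram (X : nat -> Prop) (C : structure unary_language) (n : nat) :
  Iso (flag_structure X) C ->
  (positive_diagram C n <->
   join eq_set (join neq_set (infinite_join (fun i _ => X i))) n).
Proof.
intros HC.
assert (E : forall m, infinite_join (rel_codes C) m <-> infinite_join (fun i _ => X i) m).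
{ intros m; split.
  - intros (i & x & -> & v & _ & Hv); exists i, x; split; [reflexivity|].
    now apply (iso_flag_rel _ _ HC) in Hv.
  - intros (i & x & -> & Hi); exists i, x; split; [reflexivity|].
    exists (Vector.cons nat x 0 (Vector.nil nat)); split; [reflexivity|].
    now apply (iso_flag_rel _ _ HC). }
unfold positive_diagram, join; setoid_rewrite E; reflexivity.
Qed.

Lemma iso_flag_atomic_diagram (X : nat -> Prop) (C : structure unary_language) (i x : nat) :
  Iso (flag_structure X) C -> (atomic_diagram C (2 * ⟨i, x⟩) <-> X i).
Proof.
intros HC; split.
- intros [(m & E & j & y & -> & v & _ & Hv)|(m & E & _)]; [|lia].
  apply (iso_flag_rel _ _ HC) in Hv.
  replace i with j; [assumption|].
  apply (pair_inj j y i x); lia.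
- intros Hi; left; exists ⟨i, x⟩; split; [reflexivity|].
  exists i, x; split; [reflexivity|].
  exists (Vector.cons nat x 0 (Vector.nil nat)); split; [reflexivity|].
  now apply (iso_flag_rel _ _ HC).
Qed.

Lemma flag_atomic_diagram_agree (s : nat) (X Y : nat -> Prop) :
  agree_below s X Y ->
  agree_below s (atomic_diagram (flag_structure X)) (atomic_diagram (flag_structure Y)).
Proof.
assert (H : forall X Y, agree_below s X Y -> forall k, k < s ->
  atomic_diagram (flag_structure X) k -> atomic_diagram (flag_structure Y) k).
{ clear X Y; intros X Y HXY k Hk [(m & E & i & x & -> & v & Ev & Hv)|(m & E & i & x & -> & v & Ev & Hv)];
    pose proof (pair_bounds i x);
    [left|right]; exists ⟨i, x⟩; split; auto; exists i, x; split; auto;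
    exists v; split; auto; simpl in *; rewrite <- (HXY i); auto; lia. }
intros HXY k Hk; split; eapply H; eauto.
intros j Hj; symmetry; auto.
Qed.

(** * Positive enumerable bi-transformations *)

Definition flag_functor (X Y : nat -> Prop) :
  functor (Iso (flag_structure X)) (Iso (flag_structure Y)).
Proof.
refine (@Functor _ _ (Iso (flag_structure X)) (Iso (flag_structure Y))
  (fun _ => flag_structure Y) (fun _ _ f => f) _ _ _ _); auto.
- intros C _; apply iso_flag_refl.
- intros C D f _ _ [Hf _].
  now apply (iso_flag_bijective Y); try apply iso_flag_refl.
Defined.

Definition singleton_reducible (Y X : nat -> Prop) : Prop :=
  exists f g, computable_fun f /\ computable_fun g /\
    forall i, Y i <-> exists n, X (f n) /\ i = g n.

(** The arguments of the operator are pairs whose left component selects a summand of the positive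
    diagram: equality, inequality, or the relations. *)
Lemma positive_diagram_reduction (X Y : nat -> Prop) :
  singleton_reducible Y X ->
  exists Psi : enum_operator, forall C D,
    Iso (flag_structure X) C -> Iso (flag_structure Y) D ->
    enumerates Psi (positive_diagram C) (positive_diagram D).
Proof.
intros (f & g & Hf & Hg & HYX).
set (lift := fun (h : nat -> nat) p =>
  match pfst p with
  | 0 => 2 * psnd p
  | S k => match k with
    | 0 => S (2 * (2 * psnd p))
    | S _ => S (2 * S (2 * ⟨h (pfst (psnd p)), psnd (psnd p)⟩))
    end
  end).
assert (Hlift : forall h, computable_fun h -> computable_fun (lift h)).
{ intros h Hh.
  assert (computable_fun (fun p => h (pfst (psnd p))))
    by (apply computable_comp; auto with computable).
  apply (computable_ext (fun p => match pfst p with 0 => 2 * psnd p | S _ =>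
    match pfst p - 1 with 0 => S (2 * (2 * psnd p))
     | S _ => S (2 * S (2 * ⟨h (pfst (psnd p)), psnd (psnd p)⟩)) end end)).
  - intros p; unfold lift; destruct (pfst p) as [|k]; [reflexivity|].
    now rewrite Nat.sub_succ, Nat.sub_0_r.
  - auto 12 with computable. }
destruct (singleton_operator _ _ (Hlift f Hf) (Hlift g Hg)) as [Psi HPsi].
exists Psi; intros C D HC HD x; rewrite HPsi, (iso_flag_positive_diagram _ _ _ HD).
split.
- intros (n & Hn & ->).
  rewrite (iso_flag_positive_diagram _ _ _ HC) in Hn; unfold lift in *.
  destruct (pfst n) as [|[|k]].
  + destruct Hn as [(m & E & Hm)|(m & E & _)]; [left; eauto|lia].
  + destruct Hn as [(m & E & _)|(m & E & [(m' & -> & Hm)|(m' & -> & _)])]; try lia.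
    right; exists (2 * m'); split; [lia|]; left; eauto.
  + destruct Hn as [(m & E & _)|(m & E & [(m' & -> & Hm)|(m' & -> & i & y & -> & Hi)])]; try lia.
    right; eexists; split; [rewrite <- Nat.add_1_r; reflexivity|].
    right; eexists; split; [rewrite <- Nat.add_1_r; reflexivity|].
    exists (g (pfst (psnd n))), (psnd (psnd n)); split; [reflexivity|].
    apply HYX; exists (pfst (psnd n)); split; [|reflexivity].
    replace (f (pfst (psnd n))) with i; [assumption|].
    apply (pair_inj i y _ (psnd (psnd n))); lia.
- intros [(m & -> & Hm)|(m & -> & [(m' & -> & Hm)|(m' & -> & i & y & -> & Hi)])].
  + exists ⟨0, m⟩; unfold lift; rewrite !pfst_pair, !psnd_pair; split; [|lia].
    rewrite (iso_flag_positive_diagram _ _ _ HC); left; eauto.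
  + exists ⟨1, m'⟩; unfold lift; rewrite !pfst_pair, !psnd_pair; split; [|lia].
    rewrite (iso_flag_positive_diagram _ _ _ HC); right.
    exists (2 * m'); split; [lia|]; left; eauto.
  + apply HYX in Hi as (n & Hn & ->).
    exists ⟨2, ⟨n, y⟩⟩; unfold lift; rewrite !psnd_pair, !pfst_pair, ?psnd_pair; split; [|lia].
    rewrite (iso_flag_positive_diagram _ _ _ HC); right.
    exists (2 * ⟨f n, y⟩ + 1); split; [lia|]; right.
    exists ⟨f n, y⟩; split; [lia|]; exists (f n), y; auto.
Qed.

(** The graph of [f] is the middle summand of the oracle, which holds [x] at position
    [2 * (2 * x) + 1]. *)
Lemma flag_functor_positive_enumerable (X Y : nat -> Prop) :
  singleton_reducible Y X -> positive_enumerable_functor (flag_functor X Y).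
Proof.
intros H; destruct (positive_diagram_reduction _ _ H) as [Psi HPsi].
destruct (singleton_operator (fun x => S (2 * (2 * x))) (fun x => x)) as [Psis HPsis];
  auto with computable.
exists Psi, Psis; split.
- intros C HC; apply HPsi; [assumption | apply iso_flag_refl].
- intros C1 C2 f _ _ _ x; rewrite HPsis; simpl; split.
  + intros (n & [(m & E & _)|(m & E & [(m' & -> & Hm)|(m' & -> & _)])] & ->); try lia.
    now replace n with m' by lia.
  + intros Hx; exists x; split; [|reflexivity].
    right; exists (2 * x); split; [lia|]; left; eauto.
Qed.

Lemma graph_injective (f g : nat -> nat) : (forall n, Graph f n <-> Graph g n) -> f = g.
Proof.
intros H; apply functional_extensionality; intros x.
destruct (proj1 (H ⟨x, f x⟩)) as [y Hy]; [exists x; reflexivity|].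
apply pair_inj in Hy as [-> Hy]; exact Hy.
Qed.

(** The equality summand of a positive diagram is the graph of the identity. *)
Lemma identity_operator :
  exists Lam : enum_operator, forall (L : language) (C : structure L) g,
    enum_real Lam C g <-> g = id.
Proof.
destruct (singleton_operator (fun x => 2 * ⟨x, x⟩) (fun x => ⟨x, x⟩)) as [Lam HLam];
  auto with computable.
assert (E : forall (L : language) (C : structure L) x,
  enum_apply Lam (positive_diagram C) x <-> Graph id x).
{ intros L C x; rewrite HLam; split.
  - intros (n & _ & ->); exists n; reflexivity.
  - intros (n & ->); exists n; split; [|reflexivity].
    left; exists ⟨n, n⟩; split; [reflexivity|]; exists n, n; auto. }
exists Lam; intros L C g; unfold enum_real, enumerates; split.
- intros H; apply graph_injective; intros n; rewrite <- H; apply E.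
- intros ->; apply E.
Qed.

Lemma flag_functors_enum_pseudo_inverses (X Y : nat -> Prop) :
  enum_pseudo_inverses (flag_functor X Y) (flag_functor Y X).
Proof.
destruct identity_operator as [Lam HLam].
assert (Hid : Bijective (@id nat)) by (exists id; split; reflexivity).
exists Lam, Lam; split; [split|split; [split|split]].
- intros C HC; exists id; split; [now apply HLam|].
  apply (iso_flag_bijective X); auto; apply iso_flag_refl.
- intros C1 C2 h g1 g2 _ _ _ H1 H2; apply HLam in H1 as ->; apply HLam in H2 as ->; reflexivity.
- intros C HC; exists id; split; [now apply HLam|].
  apply (iso_flag_bijective Y); auto; apply iso_flag_refl.
- intros C1 C2 h g1 g2 _ _ _ H1 H2; apply HLam in H1 as ->; apply HLam in H2 as ->; reflexivity.
- intros C g _ Hg; apply HLam in Hg as ->; now apply HLam.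
- intros C g _ Hg; apply HLam in Hg as ->; now apply HLam.
Qed.

Lemma flag_structures_bitransformable (X Y : nat -> Prop) :
  singleton_reducible Y X -> singleton_reducible X Y ->
  positive_enumerably_bitransformable (flag_structure X) (flag_structure Y).
Proof.
intros HYX HXY; exists (flag_functor X Y), (flag_functor Y X); split; [|split].
- now apply flag_functor_positive_enumerable.
- now apply flag_functor_positive_enumerable.
- apply flag_functors_enum_pseudo_inverses.
Qed.

(** * A set whose projection is its own halting problem *)

(** Stage [n] of the construction decides the numbers less than [n]. *)
Lemma causal_fixpoint (rule : (nat -> Prop) -> nat -> Prop) :
  (forall n X Y, agree_below n X Y -> (rule X n <-> rule Y n)) ->
  exists U, forall n, U n <-> rule U n.
Proof.
intros Hrule.
set (stage := fix stage n : nat -> Prop :=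
  match n with
  | 0 => fun _ => False
  | S m => fun k => (k < m /\ stage m k) \/ (k = m /\ rule (stage m) m)
  end).
assert (Hstage : forall n, agree_below n (stage n) (fun k => rule (stage k) k)).
{ induction n as [|n IHn]; intros k Hk; [lia|]; simpl.
  destruct (Nat.eq_dec k n) as [->|Hkn].
  - split; [intros [[? ?]|[_ ?]]; [lia|assumption] | intros; right; auto].
  - specialize (IHn k ltac:(lia)); simpl in IHn; rewrite <- IHn.
    split; [intros [[_ ?]|[? _]]; [assumption|lia] | intros; left; split; [lia|assumption]]. }
exists (fun k => rule (stage k) k); intros n; apply Hrule, Hstage.
Qed.

(** [h e] is the input at which the program with index [e] is to be defeated. *)
Lemma diagonal_oracle (h : nat -> nat) :
  exists U : nat -> Prop, forall c, exists e,
    (exists s, U ⟨e, s⟩) <-> eval (atomic_diagram (flag_structure U)) c (h e) 0.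
Proof.
destruct (causal_fixpoint (fun X n => exists c, code_index c = pfst n /\
  forall Y, agree_below (psnd n) X Y ->
    eval (atomic_diagram (flag_structure Y)) c (h (pfst n)) 0)) as [U HU].
{ intros n.
  assert (Hn : psnd n <= n) by (rewrite <- (pair_eta n) at 2; apply pair_bounds).
  assert (H : forall X Y, agree_below n X Y -> (exists c, code_index c = pfst n /\
    forall Z, agree_below (psnd n) X Z ->
      eval (atomic_diagram (flag_structure Z)) c (h (pfst n)) 0) ->
    exists c, code_index c = pfst n /\
    forall Z, agree_below (psnd n) Y Z ->
      eval (atomic_diagram (flag_structure Z)) c (h (pfst n)) 0).
  { intros X Y HXY (c & Hc & H); exists c; split; [assumption|].
    intros Z HZ; apply H; intros k Hk; rewrite (HXY k) by lia; auto. }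
  intros X Y HXY; split; apply H; [assumption|].
  intros k Hk; symmetry; auto. }
exists U; intros c; exists (code_index c); split.
- intros [s Hs]; apply HU in Hs as (d & Hd & H); rewrite !pfst_pair in *.
  apply code_index_inj in Hd as ->; apply H; intros k _; reflexivity.
- intros H; destruct (eval_use _ _ _ _ H) as [s Hs]; exists s; apply HU.
  exists c; rewrite pfst_pair, psnd_pair; split; [reflexivity|].
  intros Y HY; apply Hs, flag_atomic_diagram_agree, HY.
Qed.

(** The projection alone would not suffice as the second set: [U] has to be enumerable from it in turn,
    so a shifted copy of [U] is kept next to it. *)
Definition with_projection (U : nat -> Prop) (i : nat) : Prop :=
  exists e s, U ⟨e, s⟩ /\ (i = ⟨e, 0⟩ \/ i = ⟨e, S s⟩).

Lemma with_projection_reducible (U : nat -> Prop) :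
  singleton_reducible (with_projection U) U.
Proof.
exists psnd.
exists (fun n => match pfst n with 0 => ⟨pfst (psnd n), 0⟩
                 | S _ => ⟨pfst (psnd n), S (psnd (psnd n))⟩ end).
split; [|split]; auto 10 with computable.
intros i; split.
- intros (e & s & H & [-> | ->]); [exists ⟨0, ⟨e, s⟩⟩ | exists ⟨1, ⟨e, s⟩⟩];
    rewrite !psnd_pair, !pfst_pair, ?psnd_pair; auto.
- intros (n & Hn & ->); exists (pfst (psnd n)), (psnd (psnd n)); rewrite pair_eta.
  split; [assumption|]; destruct (pfst n); auto.
Qed.

Lemma reducible_with_projection (U : nat -> Prop) :
  singleton_reducible U (with_projection U).
Proof.
exists (fun n => ⟨pfst n, S (psnd n)⟩), (fun n => n).
split; [|split]; auto with computable.
intros i; split.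
- intros H; exists i; split; [|reflexivity].
  exists (pfst i), (psnd i); rewrite pair_eta; auto.
- intros (n & (e & s & H & E) & ->).
  destruct E as [E|E]; apply pair_inj in E as [E1 E2]; [discriminate|].
  injection E2 as E2; now rewrite <- (pair_eta n), E1, E2.
Qed.

(** [2 * ⟨⟨e, 0⟩, 0⟩] codes the atomic formula that applies the relation [R_⟨e, 0⟩] to the element 0; it
    holds in the second structure exactly when [e] is in the projection of [U]. *)
Theorem proposition20 :
  exists (L L' : language) (A : structure L) (B : structure L'),
    positive_enumerably_bitransformable A B /\
    ~ computably_bitransformable A B.
Proof.
destruct (diagonal_oracle (fun e => 2 * ⟨⟨e, 0⟩, 0⟩)) as [U HU].
exists unary_language, unary_language, (flag_structure U), (flag_structure (with_projection U)).
split.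
{ apply flag_structures_bitransformable;
    [apply with_projection_reducible | apply reducible_with_projection]. }
intros (F & G & (c & _ & Hc & _) & _).
specialize (Hc _ (iso_flag_refl U)).
destruct (HU c) as [e He].
pose proof (iso_flag_atomic_diagram _ _ ⟨e, 0⟩ 0 (obj_in F (iso_flag_refl U))) as HV.
assert (Hproj : with_projection U ⟨e, 0⟩ <-> exists s, U ⟨e, s⟩).
{ split.
  - intros (e' & s & H & [E|E]); apply pair_inj in E as [-> E]; [eauto|discriminate].
  - intros [s H]; exists e, s; auto. }
rewrite Hproj in HV.
destruct (classic (exists s, U ⟨e, s⟩)) as [H|H].
- assert (H1 := Hc _ 1 (or_introl (conj (proj2 HV H) eq_refl))).
  discriminate (eval_deterministic _ _ _ _ _ H1 (proj1 He H)).
- apply H, He, Hc; right; tauto.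
Qed.
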